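(* Let $p$ be a prime, $r\ge 1$ an integer, $R=\mathbb{Z}/p^r\mathbb{Z}$, and let $P,Q\in R[\boldsymbol{x}^{\pm1}]$ be Laurent polynomials in $\boldsymbol{x}=(x_1,\dots,x_d)$. Let $\operatorname{dg}$ be any degree-like function on $R[\boldsymbol{x}^{\pm1}]$ and put $a=\operatorname{dg}(P)$, $b=\operatorname{dg}(Q)$. Run the state-construction procedure described in the context, in any of its three variants (linear, automatic, or scaling), starting from $(P_0,Q_0)=(P,Q)$. Then among the resulting states $A_i(n)=\operatorname{ct}[P_i(\boldsymbol{x})^nQ_i(\boldsymbol{x})]$ there are at most $r$ distinct Laurent polynomials $P_i$, and every $Q_i$ satisfies $$\operatorname{dg}(Q_i)\le p^{r-1}a-1+\max(0,\,b-a+1).$$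
   Context: For a Laurent polynomial $F=\sum_{\boldsymbol{k}\in\mathbb{Z}^d}a_{\boldsymbol{k}}\boldsymbol{x}^{\boldsymbol{k}}$, $\operatorname{ct}[F]=a_{\boldsymbol{0}}$ denotes its constant term, and the Cartier operator is $\Lambda_p\big[\sum_{\boldsymbol{k}}a_{\boldsymbol{k}}\boldsymbol{x}^{\boldsymbol{k}}\big]=\sum_{\boldsymbol{k}}a_{p\boldsymbol{k}}\boldsymbol{x}^{\boldsymbol{k}}$. A degree-like function is a map $\operatorname{dg}:R[\boldsymbol{x}^{\pm1}]\to\mathbb{Z}_{\ge0}$ such that $\operatorname{dg}(FG)\le\operatorname{dg}(F)+\operatorname{dg}(G)$ and $\operatorname{dg}(\Lambda_p[F])\le \operatorname{dg}(F)/p$ for all $F,G$ (e.g. total degree, or degree or low-degree in a fixed variable). A linear $p$-scheme for a sequence $A:\mathbb{Z}_{\ge0}\to R$ consists of sequences $A_0=A,A_1,\dots,A_m:\mathbb{Z}_{\ge0}\to R$ (the states) with $A_i(pn+k)=\sum_j\alpha^{(k)}_{i,j}A_j(n)$ for all $i$, all $k\in\{0,\dots,p-1\}$, all $n\ge0$, for some $\alpha^{(k)}_{i,j}\in R$. It is automatic if each right-hand side is $0$ or a single $A_j(n)$, and scaling if each right-hand side has at most one nonzero term. State-construction procedure: states are pairs $(P_i,Q_i)$ of Laurent polynomials over $R$, representing $A_i(n)=\operatorname{ct}[P_i^nQ_i]$, starting with $(P_0,Q_0)=(P,Q)$. For each existing state $i$ and each $k\in\{0,\dots,p-1\}$, set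 $\tilde P=P_i^p$, $\tilde Q=P_i^kQ_i$. If $\tilde P(\boldsymbol{x})=\hat P(\boldsymbol{x}^p)$ for some Laurent polynomial $\hat P$ over $R$, set $\hat Q=\Lambda_p[\tilde Q]$; otherwise set $\hat P=\tilde P$, $\hat Q=\tilde Q$. Then $A_i(pn+k)=\operatorname{ct}[\hat P^n\hat Q]$ in $R$. In the linear variant, if $\operatorname{ct}[\hat P^n\hat Q]$ is an $R$-linear combination of existing states of the form $\operatorname{ct}[\hat P^nQ_j]$ this is recorded as the transition; in the automatic variant one checks whether it equals an existing state; in the scaling variant whether it is an $R$-multiple of an existing state. If the check fails, $(\hat P,\hat Q)$ is added as a new state. The procedure continues until every state and every $k$ has been processed. *)

(* Defs.v *)
From HB Require Import structures.
From mathcomp Require Import all_boot all_order all_algebra.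
From mathcomp Require Import finmap monalg.

Set Implicit Arguments.
Unset Strict Implicit.
Unset Printing Implicit Defensive.

Import Order.TTheory GRing.Theory Num.Theory.

Local Open Scope fset_scope.
Local Open Scope ring_scope.

(* Laurent polynomials in d variables: finitely supported functions on the
   exponent lattice Z^d.  The ring structure that monalg puts on
   {malg R[K]} is restricted to monoids K without nontrivial units, so the
   convolution product over the group Z^d is set up here, on an alias. *)
Definition laurent (R : comNzRingType) (d : nat) : Type :=
  {malg R['rV[int]_d]}.

HB.instance Definition _ (R : comNzRingType) (d : nat) :=
  GRing.Lmodule.copy (laurent R d) {malg R['rV[int]_d]}.

Section LaurentRing.
Variables (R : comNzRingType) (d : nat).
Local Notation L := (laurent R d).
Implicit Types (F G H : L) (k : 'rV[int]_d).

Definition laurent_one : L := << 1 *g (0 : 'rV[int]_d) >>.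

Definition laurent_mul F G : L :=
  \sum_(k <- msupp F) \sum_(l <- msupp G) << F@_k * G@_l *g (k + l)%R >>.

Lemma laurent_mulw (D E : {fset 'rV[int]_d}) F G :
  msupp F `<=` D -> msupp G `<=` E ->
  laurent_mul F G =
    \sum_(k <- D) \sum_(l <- E) << F@_k * G@_l *g (k + l)%R >>.
Proof.
move=> sD sE; rewrite /laurent_mul (big_fset_incl _ sD) /=.
  apply/eq_bigr=> k _; apply/big_fset_incl => // l _ /mcoeff_outdom ->.
  by rewrite mulr0 monalgU0.
move=> k _ /mcoeff_outdom Fk.
by rewrite big1 // => l _; rewrite Fk mul0r monalgU0.
Qed.

Lemma laurent_mulC : commutative laurent_mul.
Proof.
move=> F G; rewrite /laurent_mul exchange_big; apply/eq_bigr=> k _.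
by apply/eq_bigr=> l _; rewrite mulrC addrC.
Qed.

Lemma laurent_mulDl : left_distributive laurent_mul +%R.
Proof.
move=> F G H.
rewrite [in RHS](laurent_mulw (fsubsetUl (msupp F) (msupp G)) (fsubset_refl _)).
rewrite [in RHS](laurent_mulw (fsubsetUr (msupp F) (msupp G)) (fsubset_refl _)).
rewrite (laurent_mulw (msuppD_le F G) (fsubset_refl _)).
rewrite -big_split /=; apply/eq_bigr=> k _.
rewrite -big_split /=; apply/eq_bigr=> l _.
by rewrite mcoeffD mulrDl monalgUD.
Qed.

Lemma laurent_mulDr : right_distributive laurent_mul +%R.
Proof. by move=> F G H; rewrite !(laurent_mulC F) laurent_mulDl. Qed.

Lemma laurent_mul0l : left_zero 0 laurent_mul.
Proof. by move=> F; rewrite /laurent_mul msupp0 big_seq_fset0. Qed.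

Lemma laurent_mulUU a b k l :
  laurent_mul << a *g k >> << b *g l >> = << a * b *g (k + l)%R >>.
Proof.
by rewrite (laurent_mulw msuppU_le msuppU_le) !big_seq_fset1 !mcoeffUU.
Qed.

Lemma laurent_mul_suml I (s : seq I) (f : I -> L) G :
  laurent_mul (\sum_(i <- s) f i) G = \sum_(i <- s) laurent_mul (f i) G.
Proof.
exact: (big_morph (laurent_mul^~ G) (fun _ _ => laurent_mulDl _ _ _)
  (laurent_mul0l _)).
Qed.

Lemma laurent_mul_sumr I (s : seq I) (f : I -> L) G :
  laurent_mul G (\sum_(i <- s) f i) = \sum_(i <- s) laurent_mul G (f i).
Proof.
have mulG0 : laurent_mul G 0 = 0 by rewrite laurent_mulC laurent_mul0l.
exact: (big_morph (laurent_mul G) (laurent_mulDr G) mulG0).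
Qed.

Lemma laurentE F : F = \sum_(k <- msupp F) (<< F@_k *g k >> : L).
Proof. exact: monalgE. Qed.

Lemma laurent_mulA : associative laurent_mul.
Proof.
move=> F G H; rewrite [F]laurentE !laurent_mul_suml.
apply: eq_bigr => i _; rewrite [G]laurentE laurent_mul_suml.
rewrite !laurent_mul_sumr laurent_mul_suml; apply: eq_bigr => j _.
rewrite [H]laurentE !laurent_mul_sumr; apply: eq_bigr => k _.
by rewrite !laurent_mulUU mulrA addrA.
Qed.

Lemma laurent_mul1l : left_id laurent_one laurent_mul.
Proof.
move=> F; rewrite [F in LHS]laurentE laurent_mul_sumr [RHS]laurentE.
by apply/eq_bigr=> k _; rewrite laurent_mulUU mul1r add0r.
Qed.

Lemma laurent_one_neq0 : laurent_one != 0.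
Proof. by rewrite monalgU_eq0 oner_eq0. Qed.

End LaurentRing.

HB.instance Definition _ (R : comNzRingType) (d : nat) :=
  GRing.Zmodule_isComNzRing.Build (laurent R d)
    (@laurent_mulA R d) (@laurent_mulC R d) (@laurent_mul1l R d)
    (@laurent_mulDl R d) (@laurent_one_neq0 R d).

Section Operators.
Variables (R : comNzRingType) (d : nat).
Local Notation L := (laurent R d).
Implicit Types (F G : L) (k : 'rV[int]_d).

Definition ct F : R := F@_(0 : 'rV[int]_d).

(* The explicit finite domain consists of the componentwise quotients m %/ p
   of the exponents m of F; see mcoeff_cartier. *)
Definition cartier (p : nat) F : L :=
  [malg k in [fset map_mx (fun z : int => (z %/ p%:Z)%Z) m
               | m in msupp F] => F@_(k *+ p)].

(* F(x) |-> F(x^p) *)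
Definition subst_pow (p : nat) F : L :=
  \sum_(k <- msupp F) << F@_k *g (k *+ p)%R >>.

Lemma mcoeff_cartier (p : nat) F k :
  (0 < p)%N -> (cartier p F)@_k = F@_(k *+ p).
Proof.
move=> p_gt0; rewrite mcoeffE; case: ifP => // /negbT kD.
apply/esym/mcoeff_outdom; apply: contra kD => kF.
apply/imfsetP; exists (k *+ p) => //=; apply/rowP => i.
by rewrite mxE mulmxnE -mulr_natr natz mulzK // eqz_nat -lt0n.
Qed.

Lemma subst_powK (p : nat) F : (0 < p)%N -> cartier p (subst_pow p F) = F.
Proof.
move=> p_gt0; apply/malgP => k; rewrite mcoeff_cartier // [F in RHS]laurentE.
rewrite /subst_pow !raddf_sum; apply/eq_bigr => l _; rewrite /= !mcoeffU.
congr (_ *+ _); case: (eqVneq l k) => [->|lk]; rewrite ?eqxx //.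
congr nat_of_bool; apply/negbTE; apply: contra lk => /eqP e.
apply/eqP/rowP => i; move/rowP: e => /(_ i); rewrite !mulmxnE.
by move/(pmulrnI p_gt0).
Qed.

End Operators.

(* The second condition is dg (Lambda_p F) <= dg F / p with a real quotient. *)
Definition degree_like (R : comNzRingType) (d p : nat)
    (dg : laurent R d -> nat) : Prop :=
  (forall F G, (dg (F * G)%R <= dg F + dg G)%N) /\
  (forall F, (dg (cartier p F))%:R <= (dg F)%:R / p%:R :> rat).

Inductive variant := Linear | Automatic | Scaling.

Section Procedure.
Variables (R : comNzRingType) (d p : nat).
Local Notation L := (laurent R d).

Definition state : Type := L * L.

Definition term (s : state) (n : nat) : R := ct (s.1 ^+ n * s.2).

Definition next_state (s : state) (k : nat) (t : state) : Prop :=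
  (s.1 ^+ p = subst_pow p t.1 /\ t.2 = cartier p (s.1 ^+ k * s.2)) \/
  (~ (exists G, s.1 ^+ p = subst_pow p G) /\
    t = (s.1 ^+ p, s.1 ^+ k * s.2)).

(* A configuration lists the existing states A_0, A_1, ... in order of
   creation, and the recorded transitions: an entry ((i, k), alpha) stands
   for A_i(pn+k) = \sum_j alpha j * A_j(n). *)
Record config : Type := Config {
  states : seq state;
  transitions : seq ((nat * nat) * (nat -> R))
}.

Definition processed (c : config) (i k : nat) : Prop :=
  (i, k) \in map fst (transitions c).

(* The check made on the candidate t = (hatP, hatQ): its sequence in n must be
   the combination of the existing states with coefficients alpha.  Only the
   linear variant requires the states used to have hatP as first component. *)
Definition check (v : variant) (S : seq state) (t : state)
    (alpha : nat -> R) : Prop :=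
  (forall n, term t n =
     \sum_(j < size S) alpha j * term (nth (0, 0) S j) n) /\
  match v with
  | Linear => forall j, (j < size S)%N ->
      alpha j <> 0 -> (nth (0, 0) S j).1 = t.1
  | Automatic => exists2 j0, (j0 < size S)%N &
      forall j, alpha j = (j == j0)%:R
  | Scaling => exists2 j0, (j0 < size S)%N &
      forall j, j <> j0 -> alpha j = 0
  end.

Definition init (P Q : L) : config := Config [:: (P, Q)] [::].

Inductive step (v : variant) (c : config) : config -> Prop :=
| step_record i k t alpha :
    (i < size (states c))%N -> (k < p)%N -> ~ processed c i k ->
    next_state (nth (0, 0) (states c) i) k t ->
    check v (states c) t alpha ->
    step v c (Config (states c) (((i, k), alpha) :: transitions c))
| step_add i k t :
    (i < size (states c))%N -> (k < p)%N -> ~ processed c i k ->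
    next_state (nth (0, 0) (states c) i) k t ->
    ~ (exists alpha, check v (states c) t alpha) ->
    step v c (Config (rcons (states c) t)
      (((i, k), fun j => (j == size (states c))%:R) :: transitions c)).

(* The order in which the pairs (i, k) are processed, and the transition
   recorded when several are possible, are arbitrary.  All stages of a run are
   reachable configurations; its result is the one with no pair left. *)
Inductive reachable (v : variant) (P Q : L) : config -> Prop :=
| reachable_init : reachable v P Q (init P Q)
| reachable_step c c' :
    reachable v P Q c -> step v c c' -> reachable v P Q c'.

End Procedure.

(* Main.v *)
(* The first component of a state determines that of its successors.  After m
   steps it is some H with H(x)^p = H(x^p) modulo p^(m+1): raising a congruence
   modulo p^m to the power p makes it hold modulo p^(m+1), and x |-> x^p is
   injective modulo any integer.  Hence H is a fixed point after r - 1 steps,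
   and at most r - 1 steps replace H by H^p.  If u of the steps so far did, then
   dg H <= p^u a and dg Q_i < p^u a + M with M = max(0, b - a + 1); a step with
   the Cartier operator preserves the last bound because
   ((p - 1) X + (X - 1 + M)) / p = X + (M - 1) / p < X + M for X = p^u a when
   M <> 0, and has integer part at most X - 1 when M = 0. *)
Require Import Defs.
From HB Require Import structures.
From mathcomp Require Import all_boot all_order all_algebra.
From mathcomp Require Import finmap monalg zify ring.

Set Implicit Arguments.
Unset Strict Implicit.
Unset Printing Implicit Defensive.

Import Order.TTheory GRing.Theory Num.Theory.

Local Open Scope ring_scope.

(** * Congruences modulo multiples of an integer *)

Section ModuloMultiples.
Variable A : comPzRingType.
Implicit Types (x y z : A) (n p : nat).

Definition eqmodr n x y : Prop := exists z, x = y + z *+ n.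

Lemma eqmodr_refl n x : eqmodr n x x.
Proof. by exists 0; rewrite mul0rn addr0. Qed.

Lemma eqmodr_trans n y x z : eqmodr n x y -> eqmodr n y z -> eqmodr n x z.
Proof. by move=> [u ->] [v ->]; exists (v + u); rewrite mulrnDl addrA. Qed.

Lemma eqmodrD n x y x' y' :
  eqmodr n x y -> eqmodr n x' y' -> eqmodr n (x + x') (y + y').
Proof. by move=> [u ->] [v ->]; exists (u + v); rewrite mulrnDl addrACA. Qed.

(** The factor [x * y] is kept in the error term: when [y] is a multiple of [p^m], it makes that
    term a multiple of [p^(m+1)]. *)
Lemma exprD_prime p x y : prime p ->
  exists z, (x + y) ^+ p = x ^+ p + y ^+ p + x * y * z *+ p.
Proof.
move=> p_pr; have p_gt0 := prime_gt0 p_pr.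
case: p p_pr p_gt0 => // q p_pr _.
(* The [i]-th summand is the binomial term of index [i+1] divided by [p x y]. *)
exists (\sum_(i < q) x ^+ (q - i.+1) * y ^+ i *+ ('C(q.+1, i.+1) %/ q.+1)).
rewrite exprDn big_ord_recl big_ord_recr /= subn0 expr0 mulr1 bin0 mulr1n.
rewrite /bump /= !add1n subnn expr0 mul1r binn mulr1n -addrA.
congr (_ + _); rewrite addrC; congr (_ + _).
rewrite mulr_sumr -sumrMnl; apply: eq_bigr => i _.
have lt_iq := ltn_ord i.
have dvd_bin: (q.+1 %| 'C(q.+1, i.+1))%N.
  by apply: prime_dvd_bin p_pr _; lia.
rewrite /bump /= !add1n mulrnAr -mulrnA divnK // exprS subSS.
by rewrite -(subnSK lt_iq) exprS; congr (_ *+ _); ring.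
Qed.

(** With [x = y + z p^m], the mixed terms carry [p^m * p] and the last one [p^(m p)], where
    [m p >= m + 1] because [p >= 2] and [m > 0]. *)
Lemma eqmodr_exp_prime p m x y : prime p -> (0 < m)%N ->
  eqmodr (p ^ m) x y -> eqmodr (p ^ m.+1) (x ^+ p) (y ^+ p).
Proof.
move=> p_pr m_gt0 [z ->]; have p_gt1 := prime_gt1 p_pr.
have [w ->] := exprD_prime y (z *+ p ^ m) p_pr.
exists (z ^+ p *+ (p ^ (m * p - m.+1)) + y * z * w).
rewrite mulrnDl addrA exprMn_n -!mulrnA -expnM -expnD.
rewrite subnK; last nia.
by rewrite mulrnAr mulrnAl -mulrnA expnSr.
Qed.

End ModuloMultiples.

(** * The substitution of x^p for x as a ring morphism *)

Section Substitution.
Variables (R : comNzRingType) (d p : nat).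
Local Notation L := (laurent R d).
Implicit Types (F G : L) (k : 'rV[int]_d).

Lemma subst_poww (D : {fset 'rV[int]_d}) F : (msupp F `<=` D)%fset ->
  subst_pow p F = \sum_(k <- D) << F@_k *g (k *+ p)%R >>.
Proof.
move=> sD; rewrite /subst_pow (big_fset_incl _ sD) // => k _.
by move=> /mcoeff_outdom ->; rewrite monalgU0.
Qed.

Lemma subst_powD : {morph (@subst_pow R d p) : F G / F + G}.
Proof.
move=> F G; rewrite (subst_poww (msuppD_le F G)).
rewrite (subst_poww (fsubsetUl (msupp F) (msupp G))).
rewrite (subst_poww (fsubsetUr (msupp F) (msupp G))).
by rewrite -big_split; apply: eq_bigr => k _; rewrite mcoeffD monalgUD.
Qed.

Lemma subst_pow0 : @subst_pow R d p 0 = 0.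
Proof. by rewrite /subst_pow msupp0 big_seq_fset0. Qed.

Lemma subst_powU a k : subst_pow p (<< a *g k >> : L) = << a *g (k *+ p)%R >>.
Proof. by rewrite (subst_poww msuppU_le) big_seq_fset1 mcoeffUU. Qed.

HB.instance Definition _ :=
  GRing.isNmodMorphism.Build L L (@subst_pow R d p) (conj subst_pow0 subst_powD).

Lemma laurent_mulE a b k l :
  (<< a *g k >> : L) * << b *g l >> = << a * b *g (k + l)%R >>.
Proof. exact: laurent_mulUU. Qed.

Lemma laurent_expU a k n :
  (<< a *g k >> : L) ^+ n = << a ^+ n *g (k *+ n)%R >>.
Proof.
elim: n => [|n IHn]; first by rewrite !expr0 mulr0n.
by rewrite !exprS IHn laurent_mulE mulrS.
Qed.

Lemma subst_powM : {morph (@subst_pow R d p) : F G / F * G}.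
Proof.
move=> F G; rewrite [F]laurentE [G]laurentE.
rewrite mulr_suml !raddf_sum mulr_suml; apply: eq_bigr => i _ /=.
rewrite mulr_sumr raddf_sum mulr_sumr; apply: eq_bigr => j _ /=.
by rewrite laurent_mulE !subst_powU laurent_mulE mulrnDl.
Qed.

Lemma subst_pow1 : @subst_pow R d p 1 = 1.
Proof. by rewrite subst_powU mul0rn. Qed.

HB.instance Definition _ :=
  GRing.isMonoidMorphism.Build L L (@subst_pow R d p) (conj subst_pow1 subst_powM).

Lemma eqmodr_subst_pow n F G :
  eqmodr n F G -> eqmodr n (subst_pow p F) (subst_pow p G).
Proof. by move=> [E ->]; exists (subst_pow p E); rewrite raddfD raddfMn. Qed.

(** [cartier] is an additive left inverse of [subst_pow], so it carries the congruence back. *)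
Lemma subst_pow_eqmodr n F G : (0 < p)%N ->
  eqmodr n (subst_pow p F) (subst_pow p G) -> eqmodr n F G.
Proof.
move=> p_gt0 [E eFG]; exists (cartier p E).
rewrite -[F](subst_powK _ p_gt0) eFG; apply/malgP => k.
rewrite mcoeffD mcoeffMn !mcoeff_cartier // mcoeffD mcoeffMn.
by rewrite -(mcoeff_cartier (subst_pow p G)) // subst_powK.
Qed.

End Substitution.

(* Every element of 'Z_n is a multiple of 1, so additivity modulo p reduces the
   claim to monomials with coefficient 1; Fermat's little theorem is not used. *)
Lemma eqmodr_Frobenius (n d p : nat) (F : laurent 'Z_n d) : prime p ->
  eqmodr p (F ^+ p) (subst_pow p F).
Proof.
move=> p_pr; have p_gt0 := prime_gt0 p_pr.
pose good (G : laurent 'Z_n d) := eqmodr p (G ^+ p) (subst_pow p G).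
have good0 : good 0.
  by rewrite /good raddf0 expr0n eqn0Ngt p_gt0; apply: eqmodr_refl.
have goodD G H : good G -> good H -> good (G + H).
  move=> gG gH; rewrite /good raddfD /=.
  apply: eqmodr_trans (eqmodrD gG gH).
  by have [z ->] := exprD_prime G H p_pr; exists (G * H * z).
rewrite -/(good F) [F]laurentE; apply: (big_ind good good0 goodD) => k _.
rewrite -[F@_k]natr_Zp monalgUMn; elim: (nat_of_ord _) => [|m IHm].
  by rewrite mulr0n.
rewrite mulrS; apply: goodD IHm.
rewrite /good laurent_expU subst_powU expr1n; exact: eqmodr_refl.
Qed.

(** * The orbit of first components *)

Section NextPolynomial.
Variables (R : comNzRingType) (d p : nat).
Local Notation L := (laurent R d).

(** The only possible preimage of [H ^+ p] under [subst_pow] is its image under [cartier], so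
    testing that one decides the case. *)
Definition reducible (H : L) : bool :=
  subst_pow p (cartier p (H ^+ p)) == H ^+ p.

Definition next_poly (H : L) : L :=
  if reducible H then cartier p (H ^+ p) else H ^+ p.

Lemma reducibleP (H : L) : (0 < p)%N ->
  reflect (exists G, H ^+ p = subst_pow p G) (reducible H).
Proof.
move=> p_gt0; apply: (iffP eqP) => [<-|[G ->]]; last by rewrite subst_powK.
by exists (cartier p (H ^+ p)).
Qed.

Lemma next_stateE (s t : state R d) k : (0 < p)%N -> next_state p s k t ->
  t = (next_poly s.1, if reducible s.1 then cartier p (s.1 ^+ k * s.2)
                      else s.1 ^+ k * s.2).
Proof.
case: t => t1 t2 p_gt0; rewrite /next_poly; case: reducibleP => // e.
  by case=> /= [[-> ->]|[]//]; rewrite subst_powK.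
by case=> /= [[e1 _]|[_ ->]//]; case: e; exists t1.
Qed.

End NextPolynomial.

Lemma iter_next_poly_eqmodr (n d p : nat) (P : laurent 'Z_n d) m : prime p ->
  let H := iter m (next_poly p) P in
  eqmodr (p ^ m.+1) (H ^+ p) (subst_pow p H).
Proof.
move=> p_pr; have p_gt0 := prime_gt0 p_pr.
elim: m => [|m IHm] /=; first exact: eqmodr_Frobenius.
set H := iter m _ P in IHm *.
have {}IHm := eqmodr_exp_prime p_pr (ltn0Sn m) IHm.
rewrite /next_poly; case: ifP => [/eqP redH|_]; last by rewrite rmorphXn.
(* Under [subst_pow] the two sides become [(H^p)^p] and [H(x^p)^p], which the raised hypothesis
   compares. *)
by apply: (subst_pow_eqmodr p_gt0); rewrite rmorphXn /= redH rmorphXn.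
Qed.

Section Stabilization.
Variables (p r d : nat) (p_pr : prime p) (r_gt0 : (0 < r)%N).
Variable P : laurent 'Z_(p ^ r) d.

Lemma laurent_Zp_mulrn (F : laurent 'Z_(p ^ r) d) : F *+ p ^ r = 0.
Proof.
(* ['Z_n] has characteristic [n] only for [n > 1]; here [0 < r] ensures it. *)
apply/malgP => k; rewrite mcoeffMn mcoeff0 -mulr_natr pchar_Zp ?mulr0 //.
by rewrite -[1%N](expn0 p) ltn_exp2l // prime_gt1.
Qed.

(** Once [m + 1 >= r], multiples of [p^(m+1)] vanish and the congruence for the [m]-th iterate is an
    equality. *)
Lemma next_poly_stable m : (r.-1 <= m)%N ->
  let H := iter m (next_poly p) P in reducible p H /\ next_poly p H = H.
Proof.
move=> le_rm H; have p_gt0 := prime_gt0 p_pr.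
have eH : H ^+ p = subst_pow p H.
  have [E] := iter_next_poly_eqmodr P m p_pr; rewrite -/H => ->.
  have -> : m.+1 = (r + (m.+1 - r))%N by lia.
  by rewrite expnD mulrnA laurent_Zp_mulrn mul0rn addr0.
have redH : reducible p H by apply/reducibleP => //; exists H.
by split=> //; rewrite /next_poly redH eH subst_powK.
Qed.

Lemma iter_next_poly_lt m :
  exists2 m', (m' < r)%N & iter m (next_poly p) P = iter m' (next_poly p) P.
Proof.
elim: m => [|m [m' lt_m'r IHm]]; first by exists 0.
rewrite iterS IHm; have [lt_mr|le_rm] := ltnP m'.+1 r; first by exists m'.+1.
by exists m' => //; apply: (next_poly_stable _).2; lia.
Qed.

End Stabilization.

(** * Degree bounds and the invariant of a run *)

Section Degree.
Variables (R : comNzRingType) (d p : nat) (dg : laurent R d -> nat).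
Hypothesis hdg : degree_like p dg.

Lemma degree_like_exp_mul k F G : (dg (F ^+ k * G)%R <= k * dg F + dg G)%N.
Proof.
elim: k => [|k IHk]; first by rewrite expr0 mul1r.
rewrite exprS -mulrA; have := hdg.1 F (F ^+ k * G); lia.
Qed.

Lemma degree_like_exp k F : (0 < k)%N -> (dg (F ^+ k)%R <= k * dg F)%N.
Proof.
by case: k => // k _; rewrite exprSr mulSnr; apply: degree_like_exp_mul.
Qed.

Lemma degree_like_cartier F : (0 < p)%N -> (dg (cartier p F) * p <= dg F)%N.
Proof.
move=> p_gt0; have := hdg.2 F.
by rewrite ler_pdivlMr ?ltr0n // -natrM ler_nat.
Qed.

End Degree.

Theorem theorem2p4 (p r d : nat) (hp : prime p) (hr : (1 <= r)%N)
    (P Q : laurent 'Z_(p ^ r) d) (dg : laurent 'Z_(p ^ r) d -> nat)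
    (hdg : degree_like p dg) (v : variant)
    (c : config 'Z_(p ^ r) d) (hc : reachable p v P Q c) :
  (size (undup [seq s.1 | s <- states c]) <= r)%N /\
  (forall s, s \in states c ->
     (dg s.2)%:Z <= (p ^ (r - 1) * dg P)%N%:Z - 1
                    + Num.max 0 ((dg Q)%:Z - (dg P)%:Z + 1)).
Proof.
have p_gt0 := prime_gt0 hp; have p_gt1 := prime_gt1 hp.
set N := Num.max 0 _.
have [M eM leM] : exists2 M : nat, N = M%:Z & (dg Q < dg P + M)%N.
  by exists `|N|%N; rewrite /N; lia.
(* [m] is an orbit index, frozen at [r - 1] once the orbit is stationary; [u] counts the steps that
   took a [p]-th power. *)
pose inv (s : state _ d) := exists m u, [/\ (u <= m < r)%N,
  s.1 = iter m (next_poly p) P, (dg s.1 <= p ^ u * dg P)%N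
  & (dg s.2 < p ^ u * dg P + M)%N].
have inv_next s t k : (k < p)%N -> inv s -> next_state p s k t -> inv t.
  move=> lt_kp [m [u [/andP[le_um lt_mr] es1 dg1 dg2]]].
  move=> /(next_stateE p_gt0) ->.
  (* With [X = p^u * dg P] and [k <= p - 1], the degree is below [(p - 1) X + X + M]. *)
  have dgk : (dg (s.1 ^+ k * s.2)%R < p * (p ^ u * dg P) + M)%N.
    have := degree_like_exp_mul hdg k s.1 s.2; nia.
  have dgp : (dg (s.1 ^+ p)%R <= p * (p ^ u * dg P))%N.
    have := degree_like_exp hdg s.1 p_gt0; nia.
  have [m' m'P em'] : exists2 m', (m <= m' < r)%N &
      next_poly p s.1 = iter m' (next_poly p) P.
    have [lt_mr1|le_rm] := ltnP m.+1 r.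
      by exists m.+1; [lia | rewrite es1].
    exists m; first lia.
    by rewrite es1; apply: (next_poly_stable hp hr _ _).2; lia.
  have [red|nred] := boolP (reducible p s.1).
    exists m', u; split=> //=; first lia.
      rewrite /next_poly red.
      have := degree_like_cartier hdg (s.1 ^+ p) p_gt0; nia.
    (* A degree of at least [X + M] would give [p (X + M) < p X + M], which is impossible. *)
    have := degree_like_cartier hdg (s.1 ^+ k * s.2) p_gt0; nia.
  (* A non-reducible step occurs only before the orbit is stationary, which leaves room to raise
     both [m] and [u]. *)
  have lt_mr1 : (m.+1 < r)%N.
    rewrite ltnNge; apply: contra nred => le_rm; rewrite es1.
    by apply: (next_poly_stable hp hr _ _).1; lia.
  rewrite /next_poly (negbTE nred); exists m.+1, u.+1; split.
  - lia.
  - by rewrite iterS -es1 /next_poly (negbTE nred).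
  - by rewrite expnS -mulnA; exact: dgp.
  - by rewrite expnS -mulnA; exact: dgk.
have inv_states s : s \in states c -> inv s.
  elim: hc s => [|c1 c2 _ IHc st] s.
    rewrite inE => /eqP ->; exists 0, 0; rewrite /= expn0 mul1n.
    by split.
  case: st => [i k t alpha|i k t] lt_i lt_k _ nst _ /=; first exact: IHc.
  rewrite mem_rcons inE => /predU1P[->|]; last exact: IHc.
  by apply: inv_next nst => //; apply/IHc/mem_nth.
split=> [|[H G] /inv_states [m [u [lt_umr _ _ /= dg2]]]]; last first.
  have : (p ^ u <= p ^ (r - 1))%N by rewrite leq_exp2l //; lia.
  rewrite eM => le_pu.
  have : (p ^ u * dg P <= p ^ (r - 1) * dg P)%N by rewrite leq_mul2r le_pu orbT.
  lia.
(* All first components lie among the [r] orbit points of index below [r]. *)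
rewrite -[leqRHS](size_iota 0) -(size_map (fun m => iter m (next_poly p) P)).
apply: uniq_leq_size (undup_uniq _) _ => H.
rewrite mem_undup => /mapP[s /inv_states [m [u [lt_umr -> _ _]]] ->].
by apply: map_f; rewrite mem_iota; lia.
Qed.
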